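(* Let $\mathbb{K}\in\{\mathbb{R},\mathbb{C}\}$ and let $\mathcal{A}$ be a unital Banach algebra over $\mathbb{K}$. (a) For any right Banach $\mathcal{A}$-modules $\mathcal{M}$ and $\mathcal{N}$ and any distinct contractive $\mathcal{A}$-module homomorphisms $\alpha,\beta\colon\mathcal{M}\to\mathcal{N}$, there exists a contractive $\mathcal{A}$-module homomorphism $\varphi\colon\mathcal{N}\to\mathcal{A}^*$ such that $\varphi\alpha\neq\varphi\beta$. (b) For every right Banach $\mathcal{A}$-module $\mathcal{M}$, the canonical $\mathcal{A}$-module morphism $$\mathcal{M}\longrightarrow\prod_{\varphi\in\mathcal{M}_1^*}\mathcal{A}^*$$ which sends $m\in\mathcal{M}$ to the family $(a\mapsto\varphi(ma))_{\varphi\in\mathcal{M}_1^*}$ is an isometric embedding. (c) If $\mathcal{N}$ is a right Banach $\mathcal{A}$-module and $\mathcal{M}\subseteq\mathcal{N}$ a closed submodule, then every contractive $\mathcal{A}$-module map $\mathcal{M}\to\mathcal{A}^*$ can be extended to a contractive $\mathcal{A}$-module map $\mathcal{N}\to\mathcal{A}^*$.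
   Context: A unital Banach algebra is a Banach space $\mathcal{A}$ with an associative unital multiplication such that $\|ab\|\le\|a\|\|b\|$ and $\|1\|\le1$. A right Banach $\mathcal{A}$-module is a Banach space $\mathcal{M}$ with a bilinear, associative right action satisfying $\|ma\|\le\|m\|\|a\|$ and $m1=m$. The dual Banach space $\mathcal{A}^*$ is a right Banach $\mathcal{A}$-module via $(\varphi\cdot a)(x)=\varphi(ax)$. $\mathcal{M}_1^*$ is the set of contractive linear functionals $\mathcal{M}\to\mathbb{K}$ (the closed unit ball of $\mathcal{M}^*$). The product in (b) is the $\ell^\infty$-sum: uniformly bounded families $(\varphi_\psi)_{\psi\in\mathcal{M}_1^*}$ in $\mathcal{A}^*$ with norm $\sup_\psi\|\varphi_\psi\|$ and componentwise action. *)

(* Defs.v *)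
From HB Require Import structures.
From mathcomp Require Import all_boot all_order all_algebra.
From mathcomp Require Import complex.
From mathcomp Require Import mathcomp_extra boolp classical_sets functions.
From mathcomp Require Import reals topology normedtype.

Set Implicit Arguments.
Unset Strict Implicit.
Unset Printing Implicit Defensive.

Import Order.TTheory GRing.Theory Num.Def Num.Theory.
Import numFieldNormedType.Exports.

Local Open Scope classical_set_scope.
Local Open Scope ring_scope.

Variant scalar_kind := real_scalars | complex_scalars.

Definition scalarField (R : realType) (k : scalar_kind) : numFieldType :=
  match k with real_scalars => R | complex_scalars => R[i] end.

(* Norms take their values in the scalar field, so a supremum of norms has to
   be a scalar.  Meaningful only for sets of (real) nonnegative scalars, the
   empty set having supremum 0. *)
Definition scalar_sup (R : realType) (k : scalar_kind) :
    set (scalarField R k) -> scalarField R k :=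
  match k return set (scalarField R k) -> scalarField R k with
  | real_scalars => fun S => sup S
  | complex_scalars => fun S => (sup [set complex.Re z | z in S])%:C%C
  end.
Arguments scalar_sup {R k} S.

Section scalar_sup_theory.
Variables (R : realType) (k : scalar_kind).
Local Notation K := (scalarField R k).
Implicit Types (S : set K) (c : K).

Lemma scalar_sup_ub S c : (forall x, S x -> 0 <= x <= c) ->
  forall x, S x -> x <= scalar_sup S.
Proof.
case: k S c => /= S c Sc x Sx.
  by apply: ub_le_sup => //; exists c => y /Sc /andP[].
have /andP[] := Sc _ Sx; rewrite !lecE /= => /andP[/eqP x0 xr] _.
rewrite x0 eqxx /=; apply: ub_le_sup; last by exists x.
by exists (complex.Re c) => _ [y /Sc + <-]; rewrite !lecE => /andP[_ /andP[]].
Qed.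

Lemma scalar_sup_le S c : 0 <= c -> (forall x, S x -> 0 <= x <= c) ->
  scalar_sup S <= c.
Proof.
case: k S c => /= S c c0 Sc.
  have [->|/set0P S0] := eqVneq S set0; first by rewrite sup0.
  by apply: ge_sup => // x /Sc /andP[].
move: c0; rewrite !lecE /= => /andP[/eqP c0 cr]; rewrite c0 eqxx /=.
have [->|/set0P [x Sx]] := eqVneq S set0; first by rewrite image_set0 sup0.
apply: ge_sup; first by exists (complex.Re x); exists x.
by move=> _ [y /Sc + <-]; rewrite !lecE => /andP[_ /andP[]].
Qed.

Lemma scalar_sup_ge0 S : (forall x, S x -> 0 <= x) -> 0 <= scalar_sup S.
Proof.
case: k S => /= S S0.
  have [[[x Sx] Sb]|/sup_out ->//] := pselect (has_sup S).
  by apply: (le_trans (S0 _ Sx)); apply: ub_le_sup.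
rewrite lecE /= eqxx /=; set T := [set _ | _ in _].
have [[[x Tx] Tb]|/sup_out ->//] := pselect (has_sup T).
apply: (@le_trans _ _ x); last exact: ub_le_sup.
by case: Tx => y /S0 + <-; rewrite lecE => /andP[].
Qed.

Lemma complex_complete (F : set_system R[i]^o) :
  ProperFilter F -> cauchy F -> cvg F.
Proof.
move=> FF /cauchyP Fc.
have part (p : {additive R[i] -> R}) : (forall z, `|p z|%:C%C <= `|z|) ->
    cvg ((p : R[i]^o -> R) @ F).
  move=> pN; apply: R_complete; apply/cauchyP => e e0.
  have [|z Fz] := Fc e%:C%C; first by rewrite ltcR.
  exists (p z); suff : F [set y | ball (p z) e (p y)] by [].
  apply: filterS Fz => y; rewrite -!ball_normE /= -(raddfB p) -ltcR.
  exact/le_lt_trans/pN.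
have /cvg_ex[/= a Fa] : cvg ((@complex.Re R : R[i]^o -> R) @ F).
  by apply: (part (@complex.Re R)) => z; exact: normc_ge_Re.
have /cvg_ex[/= b Fb] : cvg ((@complex.Im R : R[i]^o -> R) @ F).
  apply: (part (@complex.Im R)) => -[x y].
  by rewrite normc_def lecR /= -sqrtr_sqr ler_wsqrtr// lerDr sqr_ge0.
apply/cvg_ex; exists (a +i* b)%C; apply/cvgrPdist_lt => -[e e'].
rewrite ltcE /= => /andP[/eqP -> e0].
have e20 : 0 < e / 2 by rewrite divr_gt0.
move/cvgrPdist_lt : Fa => /(_ _ e20); move/cvgrPdist_lt : Fb => /(_ _ e20).
apply: filterS2 => -[x y] /= xe ye.
have -> : ((a +i* b)%C - (x +i* y)%C : R[i]^o) =
  (a - x)%:C%C + (0 +i* (b - y))%C by simpc.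
rewrite (le_lt_trans (ler_normD _ _))// !normc_def -raddfD ltcR /=.
rewrite !expr0n /= addr0 add0r !sqrtr_sqr [e]splitr.
by rewrite ltrD.
Qed.

Lemma scalar_complete (F : set_system K^o) : ProperFilter F -> cauchy F -> cvg F.
Proof.
case: k F => /= F FF Fc; [exact: R_complete|exact: complex_complete].
Qed.

End scalar_sup_theory.

(* The library hierarchy reserves the join of rings and normed modules for
   number domains, hence the multiplication carried by the mixin.  The zero
   algebra is allowed. *)
HB.mixin Record isBanachAlgebra (K : numFieldType) A
    & CompleteNormedModule K A := {
  bmul : A -> A -> A;
  bone : A;
  bmulA : forall x y z, bmul x (bmul y z) = bmul (bmul x y) z;
  bmul1l : forall x, bmul bone x = x;
  bmul1r : forall x, bmul x bone = x;
  bmulDl : forall x y z, bmul (x + y) z = bmul x z + bmul y z;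
  bmulDr : forall x y z, bmul x (y + z) = bmul x y + bmul x z;
  bmulZl : forall (c : K) x y, bmul (c *: x) y = c *: bmul x y;
  bmulZr : forall (c : K) x y, bmul x (c *: y) = c *: bmul x y;
  ler_norm_bmul : forall x y, `|bmul x y| <= `|x| * `|y|;
  ler_norm_bone : `|bone| <= 1
}.

#[short(type="banachAlgType")]
HB.structure Definition BanachAlgebra (K : numFieldType) :=
  {A of CompleteNormedModule K A & isBanachAlgebra K A}.

HB.mixin Record isBanachModule (K : numFieldType) (A : banachAlgType K) M
    & CompleteNormedModule K M := {
  ract : M -> A -> M;
  ractDl : forall m n a, ract (m + n) a = ract m a + ract n a;
  ractDr : forall m a b, ract m (a + b) = ract m a + ract m b;
  ractZl : forall (c : K) m a, ract (c *: m) a = c *: ract m a;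
  ractZr : forall (c : K) m a, ract m (c *: a) = c *: ract m a;
  ractA : forall m a b, ract (ract m a) b = ract m (bmul a b);
  ract1 : forall m, ract m bone = m;
  ler_norm_ract : forall m a, `|ract m a| <= `|m| * `|a|
}.

#[short(type="banachModType")]
HB.structure Definition BanachModule (K : numFieldType) (A : banachAlgType K) :=
  {M of CompleteNormedModule K M & isBanachModule K A M}.

Section sup_norm.
Variables (R : realType) (k : scalar_kind).
Local Notation K := (scalarField R k).
Variables (T : Type) (V : normedModType K) (D : set T).
Implicit Types f g : T -> V.

Definition sup_norm f : K := scalar_sup [set `|f t| | t in D].

Definition bdd_on f := exists c, forall t, D t -> `|f t| <= c.

Lemma sup_norm_ge0 f : 0 <= sup_norm f.
Proof. by apply: scalar_sup_ge0 => _ [t _ <-]. Qed.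

Lemma sup_norm_ub f : bdd_on f -> forall t, D t -> `|f t| <= sup_norm f.
Proof.
move=> [c fc] t Dt; apply: (@scalar_sup_ub _ _ _ c); last by exists t.
by move=> _ [s Ds <-]; rewrite normr_ge0 fc.
Qed.

Lemma sup_norm_le f c : 0 <= c -> (forall t, D t -> `|f t| <= c) ->
  sup_norm f <= c.
Proof.
move=> c0 fc; apply: scalar_sup_le => // _ [s Ds <-].
by rewrite normr_ge0 fc.
Qed.

Lemma sup_normD f g : bdd_on f -> bdd_on g ->
  sup_norm (f + g) <= sup_norm f + sup_norm g.
Proof.
move=> bf bg; apply: sup_norm_le; first by rewrite addr_ge0 ?sup_norm_ge0.
move=> t Dt; apply: (le_trans (ler_normD _ _)).
by rewrite lerD// sup_norm_ub.
Qed.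

Lemma bdd_onZ (l : K) f : bdd_on f -> bdd_on (l *: f).
Proof.
move=> [c fc]; exists (`|l| * c) => t Dt.
by rewrite normrZ ler_wpM2l// fc.
Qed.

Lemma sup_normZ (l : K) f : bdd_on f -> sup_norm (l *: f) = `|l| * sup_norm f.
Proof.
have le1 c g : bdd_on g -> sup_norm (c *: g) <= `|c| * sup_norm g.
  move=> bg; apply: sup_norm_le; first by rewrite mulr_ge0 ?sup_norm_ge0.
  by move=> t Dt; rewrite normrZ ler_wpM2l// sup_norm_ub.
move=> bf; apply/eqP; rewrite eq_le le1//=.
have [->|l0] := eqVneq l 0; first by rewrite normr0 mul0r sup_norm_ge0.
rewrite -ler_pdivlMl ?normr_gt0// -normfV.
by rewrite -{1}(scalerK l0 f) le1//; exact: bdd_onZ.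
Qed.

Lemma sup_norm_eq0 f : bdd_on f -> sup_norm f = 0 -> forall t, D t -> f t = 0.
Proof.
move=> bf f0 t Dt; apply/eqP; rewrite -normr_le0 -f0.
exact: sup_norm_ub.
Qed.

End sup_norm.

Section evaluation_complete.
Variables (K : numFieldType) (V W : normedModType K) (T : Type).
Variables (ev : T -> V -> W) (w : T -> K).
Hypothesis w_ge0 : forall t, 0 <= w t.
Hypothesis evB : forall t u v, ev t (u - v) = ev t u - ev t v.
Hypothesis ev_le : forall t (v : V), `|ev t v| <= `|v| * w t.
Hypothesis le_ev : forall (v : V) c, 0 <= c ->
  (forall t, `|ev t v| <= c * w t) -> `|v| <= c.
Hypothesis W_complete :
  forall F : set_system W, ProperFilter F -> cauchy F -> cvg F.
Hypothesis ev_lift : forall (F : set_system V) (g : T -> W), ProperFilter F ->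
  (forall t, ev t @ F --> g t) -> (exists c, forall t, `|g t| <= c * w t) ->
  exists v, forall t, ev t v = g t.

Lemma evaluation_complete (F : set_system V) :
  ProperFilter F -> cauchy F -> cvg F.
Proof.
move=> FF /cauchyP Fc.
have evc t : cvg (ev t @ F).
  apply: W_complete; apply/cauchyP => e e0.
  have wt1 : 0 < w t + 1 by rewrite ltr_wpDl.
  have [|v Fv] := Fc (e / (w t + 1)); first by rewrite divr_gt0.
  exists (ev t v); suff : F [set u | ball (ev t v) e (ev t u)] by [].
  apply: filterS Fv => u; rewrite -!ball_normE /= -evB => uv.
  rewrite (le_lt_trans (ev_le _ _))//.
  apply: (@le_lt_trans _ _ (`|v - u| * (w t + 1))).
    by rewrite ler_wpM2l// lerDl.
  by rewrite -ltr_pdivlMr.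
pose g t := lim (ev t @ F).
have near_g v e : F (ball v e) -> forall t, `|ev t v - g t| <= e * w t.
  move=> Fv t; apply/ler_addgt0Pr => d d0.
  have /cvgrPdist_lt /(_ _ d0) Fd := evc t.
  have Fd' : F [set u | `|g t - ev t u| < d] by [].
  have [u [/= gu]] := filter_ex (filterI Fd' Fv).
  rewrite -ball_normE /= => uv.
  rewrite -(subrK (ev t u) (ev t v)) -addrA (le_trans (ler_normD _ _))//.
  rewrite lerD//; last by rewrite distrC ltW.
  rewrite -evB (le_trans (ev_le _ _))// ler_wpM2r//.
  exact: ltW.
have [||v vg] := ev_lift (F := F) (g := g); first by move=> t; exact: evc.
  have [|v Fv] := Fc 1; first by [].
  exists (1 + `|v|) => t; rewrite -(subrK (ev t v) (g t)).
  rewrite (le_trans (ler_normD _ _))// mulrDl lerD//.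
  by rewrite distrC near_g.
apply/cvg_ex; exists v; apply/cvgrPdist_le => e e0.
have e20 : 0 < e / 2 by rewrite divr_gt0.
have [u Fu] := Fc _ e20.
have vu : `|u - v| <= e / 2.
  by apply: le_ev => [|t]; [exact: ltW|rewrite evB vg near_g].
apply: filterS Fu => x; rewrite -ball_normE /= => ux.
rewrite (splitr e) -(subrK u v) -addrA (le_trans (ler_normD _ _))// lerD//.
  by rewrite distrC.
exact: ltW.
Qed.

End evaluation_complete.

Section dual_space.
Variables (R : realType) (k : scalar_kind).
Local Notation K := (scalarField R k).
Variable X : normedModType K.

Definition is_functional : {pred X -> K^o} :=
  fun f => `[< linear f /\ continuous f >].

Record dual_space := Dual {
  dual_fun :> X -> K^o;
  dualP : dual_fun \in is_functional
}.

HB.instance Definition _ := [isSub of dual_space for dual_fun].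
HB.instance Definition _ := [Choice of dual_space by <:].

Lemma is_functional_submod : submod_closed is_functional.
Proof.
split.
  apply/asboolP; split; last by move=> x; exact: cvg_cst.
  by move=> a x y; rewrite -[LHS]/(0 : K^o) -[RHS]/(a *: (0 : K^o) + 0) scaler0 addr0.
move=> a f g /asboolP[fl fc] /asboolP[gl gc]; apply/asboolP; split.
  move=> b x y.
  rewrite -[LHS]/(a *: f (b *: x + y) + g (b *: x + y)).
  rewrite -[RHS]/(b *: (a *: f x + g x) + (a *: f y + g y)).
  rewrite fl gl !scalerDr !scalerA mulrC.
  by rewrite addrACA.
by move=> x; apply: cvgD; [apply: cvgZr; exact: fc|exact: gc].
Qed.

HB.instance Definition _ := GRing.SubChoice_isSubLmodule.Build
  K (X -> K^o) is_functional dual_space is_functional_submod.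

Lemma dual_is_linear (f : dual_space) : linear f.
Proof. by have /asboolP[] := dualP f. Qed.

HB.instance Definition _ (f : dual_space) :=
  GRing.isLinear.Build K X K^o _ (dual_fun f) (dual_is_linear f).

Lemma dual_continuous (f : dual_space) : continuous f.
Proof. by have /asboolP[] := dualP f. Qed.

Lemma is_functionalP (f : X -> K^o) : linear f ->
  (exists c, forall x, `|f x| <= c * `|x|) -> f \in is_functional.
Proof.
move=> fl [c fc]; apply/asboolP; split=> // x.
pose d := `|c| + 1.
have d0 : 0 < d by rewrite ltr_wpDl.
have fd y : `|f y| <= d * `|y|.
  have [->|y0] := eqVneq y 0.
    by have := fc 0; rewrite !normr0 !mulr0.
  apply: (le_trans (fc y)); rewrite ler_wpM2r//.
  have cr : c \is Num.real.
    rewrite -(mulfK (_ : `|y| != 0) c) ?normr_eq0// realM ?realV ?normr_real//.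
    exact: ger0_real (le_trans (normr_ge0 _) (fc y)).
  by rewrite (le_trans (real_ler_norm cr))// lerDl.
have fB u v : f (u - v) = f u - f v.
  by rewrite addrC -scaleN1r fl scaleN1r addrC.
apply/cvgrPdist_lt => e e0; near=> y; rewrite -fB.
rewrite (le_lt_trans (fd _))// -ltr_pdivlMl// mulrC.
near: y; apply: cvgr_dist_lt => //; rewrite divr_gt0//.
Unshelve. all: by end_near. Qed.

Lemma dual_bounded (f : dual_space) : exists2 c, 0 < c & forall x, `|f x| <= c * `|x|.
Proof.
have /linear_boundedP/pinfty_ex_gt0 [c c0 fc] : bounded_near f (nbhs (0 : X)).
  exact/linear_bounded_continuous/dual_continuous.
by exists c.
Qed.

Definition dual_norm (f : dual_space) : K := sup_norm [set x | `|x| <= 1] f.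

Lemma dual_bdd_on (f : dual_space) : bdd_on [set x | `|x| <= 1] f.
Proof.
have [c c0 fc] := dual_bounded f; exists c => x /= x1.
by rewrite (le_trans (fc x))// ler_piMr// ltW.
Qed.

Lemma ler_dual_norm (f : dual_space) x : `|f x| <= dual_norm f * `|x|.
Proof.
have [->|x0] := eqVneq x 0; first by rewrite linear0 !normr0 mulr0.
have nx : 0 < `|x| by rewrite normr_gt0.
have a0 : 0 <= `|x|^-1 by rewrite invr_ge0.
rewrite -ler_pdivrMr// mulrC -[X in X * _](ger0_norm a0) -normrZ -linearZ.
apply: sup_norm_ub; first exact: dual_bdd_on.
by rewrite /= normrZ ger0_norm// mulVf ?gt_eqF.
Qed.

Lemma dual_norm_le (f : dual_space) c : 0 <= c ->
  (forall x, `|f x| <= c * `|x|) -> dual_norm f <= c.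
Proof.
move=> c0 fc; apply: sup_norm_le => // x /= x1.
by rewrite (le_trans (fc x))// ler_piMr.
Qed.

Lemma dual_normD f g : dual_norm (f + g) <= dual_norm f + dual_norm g.
Proof. exact: sup_normD (dual_bdd_on f) (dual_bdd_on g). Qed.

Lemma dual_normZ (l : K) f : dual_norm (l *: f) = `|l| * dual_norm f.
Proof. exact: sup_normZ (dual_bdd_on f). Qed.

Lemma dual_norm_eq0 f : dual_norm f = 0 -> f = 0.
Proof.
move=> f0; apply/val_inj/funext => x /=; apply/eqP.
by rewrite -normr_le0 (le_trans (ler_dual_norm f x))// f0 mul0r.
Qed.

HB.instance Definition _ :=
  Lmodule_isNormed.Build K dual_space dual_normD dual_normZ dual_norm_eq0.

Lemma ler_dual (f : dual_space) x : `|f x| <= `|f| * `|x|.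
Proof. exact: ler_dual_norm. Qed.

Lemma dual_le (f : dual_space) c : 0 <= c ->
  (forall x, `|f x| <= c * `|x|) -> `|f| <= c.
Proof. exact: dual_norm_le. Qed.

Lemma dual_complete (F : set_system dual_space) : ProperFilter F -> cauchy F -> cvg F.
Proof.
apply: (@evaluation_complete K dual_space K^o X (fun x f => f x) (fun x => `|x|)) => //.
- by move=> x f; exact: ler_dual.
- by move=> f c; exact: dual_le.
- by move=> G; exact: scalar_complete.
move=> G g GG Gg gc.
have gl : linear g.
  move=> a x y; apply: (cvg_unique _ (Gg (a *: x + y))); first exact: norm_hausdorff.
  rewrite (_ : (fun f : dual_space => f (a *: x + y) : K^o) =
               (fun f : dual_space => a *: (f x : K^o) + f y)); last first.
    by apply/funext => f; exact: linearP.
  by apply: cvgD; [apply: cvgZr; exact: Gg|exact: Gg].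
by exists (Dual (is_functionalP gl gc)).
Qed.

HB.instance Definition _ := Uniform_isComplete.Build dual_space dual_complete.

End dual_space.
Arguments is_functional {R k} X _.

Section dual_module.
Variables (R : realType) (k : scalar_kind).
Local Notation K := (scalarField R k).
Variables (A : banachAlgType K) (M : banachModType A).

Lemma orbit_subproof (f : dual_space M) (m : M) :
  (fun a : A => f (ract m a) : K^o) \in is_functional A.
Proof.
apply: is_functionalP; first by move=> c a b; rewrite ractDr ractZr linearP.
exists (`|f| * `|m|) => a; rewrite (le_trans (ler_dual _ _))// -mulrA.
by rewrite ler_wpM2l// ler_norm_ract.
Qed.

Definition orbit_functional (f : dual_space M) (m : M) : dual_space A :=
  Dual (orbit_subproof f m).

Lemma orbit_functional_le f m : `|orbit_functional f m| <= `|f| * `|m|.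
Proof.
apply: dual_le => [|a]; first by rewrite mulr_ge0.
rewrite /= (le_trans (ler_dual _ _))// -mulrA.
by rewrite ler_wpM2l// ler_norm_ract.
Qed.

Lemma dual_ract_subproof (f : dual_space A) (a : A) :
  (fun x : A => f (bmul a x) : K^o) \in is_functional A.
Proof.
apply: is_functionalP; first by move=> c x y; rewrite bmulDr bmulZr linearP.
exists (`|f| * `|a|) => x; rewrite (le_trans (ler_dual _ _))// -mulrA.
by rewrite ler_wpM2l// ler_norm_bmul.
Qed.

Definition dual_ract (f : dual_space A) (a : A) : dual_space A :=
  Dual (dual_ract_subproof f a).

Lemma dual_ext (f g : dual_space A) : f =1 g -> f = g.
Proof. by move=> fg; apply/val_inj/funext. Qed.

Lemma dual_ractDl f g a : dual_ract (f + g) a = dual_ract f a + dual_ract g a.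
Proof. exact: dual_ext. Qed.

Lemma dual_ractDr f a b : dual_ract f (a + b) = dual_ract f a + dual_ract f b.
Proof.
by apply: dual_ext => x; rewrite /= bmulDl linearD.
Qed.

Lemma dual_ractZl (c : K) f a : dual_ract (c *: f) a = c *: dual_ract f a.
Proof. exact: dual_ext. Qed.

Lemma dual_ractZr (c : K) f a : dual_ract f (c *: a) = c *: dual_ract f a.
Proof. by apply: dual_ext => x; rewrite /= bmulZl linearZ. Qed.

Lemma dual_ractA f a b : dual_ract (dual_ract f a) b = dual_ract f (bmul a b).
Proof. by apply: dual_ext => x; rewrite /= bmulA. Qed.

Lemma dual_ract1 f : dual_ract f bone = f.
Proof. by apply: dual_ext => x; rewrite /= bmul1l. Qed.

Lemma ler_norm_dual_ract f a : `|dual_ract f a| <= `|f| * `|a|.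
Proof.
apply: dual_le => [|x]; first by rewrite mulr_ge0.
rewrite /= (le_trans (ler_dual _ _))// -mulrA.
by rewrite ler_wpM2l// ler_norm_bmul.
Qed.

HB.instance Definition _ := isBanachModule.Build K A (dual_space A)
  dual_ractDl dual_ractDr dual_ractZl dual_ractZr dual_ractA dual_ract1
  ler_norm_dual_ract.

End dual_module.

Section linf.
Variables (R : realType) (k : scalar_kind).
Local Notation K := (scalarField R k).
Variables (I : Type) (V : completeNormedModType K).

Definition is_bounded_family : {pred I -> V} := fun u => `[< bounded_fun u >].

Record linf := Linf {
  linf_fun :> I -> V;
  linfP : linf_fun \in is_bounded_family
}.

HB.instance Definition _ := [isSub of linf for linf_fun].
HB.instance Definition _ := [Choice of linf by <:].

Lemma is_bounded_familyP (u : I -> V) c :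
  0 <= c -> (forall i, `|u i| <= c) -> u \in is_bounded_family.
Proof.
move=> c0 uc; apply/asboolP; exists c; split; first exact: ger0_real.
by move=> d cd i _; rewrite /= (le_trans (uc i))// ltW.
Qed.

Lemma bounded_family_ex (u : I -> V) : u \in is_bounded_family ->
  exists2 c, 0 <= c & forall i, `|u i| <= c.
Proof.
move=> /asboolP /pinfty_ex_gt0 [c c0 uc]; exists c; first exact: ltW.
by move=> i; exact: uc.
Qed.

Lemma is_bounded_family_submod : submod_closed is_bounded_family.
Proof.
split; first by apply: (@is_bounded_familyP _ 0) => // i; rewrite normr0.
move=> a u v /bounded_family_ex[c c0 uc] /bounded_family_ex[d d0 vd].
apply: (@is_bounded_familyP _ (`|a| * c + d)) => [|i].
  by rewrite addr_ge0// mulr_ge0.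
rewrite (le_trans (ler_normD _ _))// lerD//.
by rewrite normrZ ler_wpM2l.
Qed.

HB.instance Definition _ := GRing.SubChoice_isSubLmodule.Build
  K (I -> V) is_bounded_family linf is_bounded_family_submod.

Definition linf_norm (u : linf) : K := sup_norm setT u.

Lemma linf_bdd_on (u : linf) : bdd_on setT u.
Proof. by have [c _ uc] := bounded_family_ex (linfP u); exists c. Qed.

Lemma linf_normD u v : linf_norm (u + v) <= linf_norm u + linf_norm v.
Proof. exact: sup_normD (linf_bdd_on u) (linf_bdd_on v). Qed.

Lemma linf_normZ (l : K) u : linf_norm (l *: u) = `|l| * linf_norm u.
Proof. exact: sup_normZ (linf_bdd_on u). Qed.

Lemma linf_norm_eq0 u : linf_norm u = 0 -> u = 0.
Proof.
move=> u0; apply/val_inj/funext => i /=.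
exact: (sup_norm_eq0 (linf_bdd_on u) u0).
Qed.

HB.instance Definition _ :=
  Lmodule_isNormed.Build K linf linf_normD linf_normZ linf_norm_eq0.

Lemma ler_linf (u : linf) i : `|u i| <= `|u|.
Proof. exact: (sup_norm_ub (linf_bdd_on u)). Qed.

Lemma linf_le (u : linf) c : 0 <= c -> (forall i, `|u i| <= c) -> `|u| <= c.
Proof. by move=> c0 uc; exact: sup_norm_le. Qed.

Lemma linf_complete (F : set_system linf) : ProperFilter F -> cauchy F -> cvg F.
Proof.
apply: (@evaluation_complete K linf V I (fun i u => u i) (fun=> 1)) => //.
- by move=> i u; rewrite mulr1; exact: ler_linf.
- by move=> u c c0 uc; apply: linf_le => // i; rewrite -[c]mulr1.
- by move=> G; exact: cauchy_cvg.
move=> G g GG Gg [c gc].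
have [c0 | nc0] := pselect (0 <= c).
  have gP : g \in is_bounded_family.
    by apply: (@is_bounded_familyP _ c) => // i; rewrite -[c]mulr1.
  by exists (Linf gP).
have I0 (i : I) : False.
  by apply: nc0; apply: (le_trans (normr_ge0 (g i))); rewrite -[c]mulr1.
by exists 0 => i; case: (I0 i).
Qed.

HB.instance Definition _ := Uniform_isComplete.Build linf linf_complete.

End linf.
Arguments is_bounded_family {R k} I V _.

Section linf_module.
Variables (R : realType) (k : scalar_kind).
Local Notation K := (scalarField R k).
Variables (A : banachAlgType K) (I : Type) (N : banachModType A).

Lemma linf_ract_subproof (u : linf I N) (a : A) :
  (fun i => ract (u i) a) \in is_bounded_family I N.
Proof.
apply: (@is_bounded_familyP _ _ _ _ _ (`|u| * `|a|)) => [|i].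
  by rewrite mulr_ge0.
by rewrite (le_trans (ler_norm_ract _ _))// ler_wpM2r// ler_linf.
Qed.

Definition linf_ract (u : linf I N) (a : A) : linf I N :=
  Linf (linf_ract_subproof u a).

Lemma linf_ext (u v : linf I N) : u =1 v -> u = v.
Proof. by move=> uv; apply/val_inj/funext. Qed.

Lemma linf_ractDl u v a : linf_ract (u + v) a = linf_ract u a + linf_ract v a.
Proof. by apply: linf_ext => i; exact: ractDl. Qed.

Lemma linf_ractDr u a b : linf_ract u (a + b) = linf_ract u a + linf_ract u b.
Proof. by apply: linf_ext => i; exact: ractDr. Qed.

Lemma linf_ractZl (c : K) u a : linf_ract (c *: u) a = c *: linf_ract u a.
Proof. by apply: linf_ext => i; exact: ractZl. Qed.

Lemma linf_ractZr (c : K) u a : linf_ract u (c *: a) = c *: linf_ract u a.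
Proof. by apply: linf_ext => i; exact: ractZr. Qed.

Lemma linf_ractA u a b : linf_ract (linf_ract u a) b = linf_ract u (bmul a b).
Proof. by apply: linf_ext => i; exact: ractA. Qed.

Lemma linf_ract1 u : linf_ract u bone = u.
Proof. by apply: linf_ext => i; exact: ract1. Qed.

Lemma ler_norm_linf_ract u a : `|linf_ract u a| <= `|u| * `|a|.
Proof.
apply: linf_le => [|i]; first by rewrite mulr_ge0.
by rewrite (le_trans (ler_norm_ract _ _))// ler_wpM2r// ler_linf.
Qed.

HB.instance Definition _ := isBanachModule.Build K A (linf I N)
  linf_ractDl linf_ractDr linf_ractZl linf_ractZr linf_ractA linf_ract1
  ler_norm_linf_ract.

End linf_module.

Record closedSubmodule (K : numFieldType) (A : banachAlgType K)
    (N : banachModType A) := ClosedSubmodule {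
  submodule_set : set N;
  submodule0 : submodule_set 0;
  submodule_linear : forall (c : K) x y,
    submodule_set x -> submodule_set y -> submodule_set (c *: x + y);
  submodule_ract : forall x (a : A), submodule_set x -> submodule_set (ract x a);
  submodule_closed : closed submodule_set
}.

Section submodule.
Variables (K : numFieldType) (A : banachAlgType K) (N : banachModType A).
Variable S : closedSubmodule N.

Definition in_submodule : {pred N} := fun x => `[< submodule_set S x >].

Record submodule := Submodule {
  submodule_val :> N;
  submoduleP : submodule_val \in in_submodule
}.

HB.instance Definition _ := [isSub of submodule for submodule_val].
HB.instance Definition _ := [Choice of submodule by <:].

Lemma in_submodule_submod : submod_closed in_submodule.
Proof.
split; first exact/asboolP/submodule0.
by move=> c x y /asboolP Sx /asboolP Sy; exact/asboolP/submodule_linear.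
Qed.

HB.instance Definition _ := GRing.SubChoice_isSubLmodule.Build
  K N in_submodule submodule in_submodule_submod.

Definition submodule_norm (x : submodule) : K := `|submodule_val x|.

Lemma submodule_normD x y :
  submodule_norm (x + y) <= submodule_norm x + submodule_norm y.
Proof. exact: ler_normD. Qed.

Lemma submodule_normZ (l : K) x : submodule_norm (l *: x) = `|l| * submodule_norm x.
Proof. exact: normrZ. Qed.

Lemma submodule_norm_eq0 x : submodule_norm x = 0 -> x = 0.
Proof. by move=> /normr0_eq0 x0; exact: val_inj. Qed.

HB.instance Definition _ := Lmodule_isNormed.Build K submodule
  submodule_normD submodule_normZ submodule_norm_eq0.

Lemma submodule_complete (F : set_system submodule) :
  ProperFilter F -> cauchy F -> cvg F.
Proof.
apply: (@evaluation_complete K submodule N unit (fun _ x => submodule_val x)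
  (fun=> 1)) => //.
- by move=> _ x; rewrite mulr1.
- by move=> x c _ /(_ tt); rewrite mulr1.
- by move=> G; exact: cauchy_cvg.
move=> G g GG /(_ tt) Gg _.
have Sg : g tt \in in_submodule.
  have nearS : \forall x \near G, submodule_set S (submodule_val x).
    by apply: filterE => x; exact/asboolP/submoduleP.
  apply/asboolP.
  have lS := closed_cvg _ (@submodule_closed _ _ _ S) nearS.
  refine (lS GG _ Gg).
by exists (Submodule Sg) => -[].
Qed.

HB.instance Definition _ := Uniform_isComplete.Build submodule submodule_complete.

Lemma submodule_ract_subproof (x : submodule) (a : A) :
  ract (submodule_val x) a \in in_submodule.
Proof. exact/asboolP/submodule_ract/asboolP/submoduleP. Qed.

Definition sub_ract (x : submodule) (a : A) : submodule :=
  Submodule (submodule_ract_subproof x a).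

Lemma sub_ractDl x y a : sub_ract (x + y) a = sub_ract x a + sub_ract y a.
Proof. by apply: val_inj; exact: ractDl. Qed.

Lemma sub_ractDr x a b : sub_ract x (a + b) = sub_ract x a + sub_ract x b.
Proof. by apply: val_inj; exact: ractDr. Qed.

Lemma sub_ractZl (c : K) x a : sub_ract (c *: x) a = c *: sub_ract x a.
Proof. by apply: val_inj; exact: ractZl. Qed.

Lemma sub_ractZr (c : K) x a : sub_ract x (c *: a) = c *: sub_ract x a.
Proof. by apply: val_inj; exact: ractZr. Qed.

Lemma sub_ractA x a b : sub_ract (sub_ract x a) b = sub_ract x (bmul a b).
Proof. by apply: val_inj; exact: ractA. Qed.

Lemma sub_ract1 x : sub_ract x bone = x.
Proof. by apply: val_inj; exact: ract1. Qed.

Lemma ler_norm_sub_ract x a : `|sub_ract x a| <= `|x| * `|a|.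
Proof. exact: ler_norm_ract. Qed.

HB.instance Definition _ := isBanachModule.Build K A submodule
  sub_ractDl sub_ractDr sub_ractZl sub_ractZr sub_ractA sub_ract1
  ler_norm_sub_ract.

End submodule.

Section homomorphisms.
Variables (K : numFieldType) (A : banachAlgType K) (M N : banachModType A).

Definition module_hom (f : M -> N) :=
  linear f /\ forall m (a : A), f (ract m a) = ract (f m) a.

Definition contractive_hom (f : M -> N) :=
  module_hom f /\ forall m, `|f m| <= `|m|.

Definition isometric_hom (f : M -> N) :=
  module_hom f /\ forall m, `|f m| = `|m|.

End homomorphisms.

Section canonical_map.
Variables (R : realType) (k : scalar_kind).
Local Notation K := (scalarField R k).
Variables (A : banachAlgType K) (M : banachModType A).

Definition dual_ball := {f : dual_space M | `|f| <= 1}.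

Lemma canonical_map_subproof (m : M) :
  (fun f : dual_ball => orbit_functional (sval f) m)
    \in is_bounded_family dual_ball (dual_space A).
Proof.
apply: (@is_bounded_familyP _ _ _ _ _ `|m|) => // -[f f1] /=.
by rewrite (le_trans (orbit_functional_le _ _))// ler_piMl.
Qed.

Definition canonical_map (m : M) : linf dual_ball (dual_space A) :=
  Linf (canonical_map_subproof m).

End canonical_map.

(* Main.v *)
(* Everything reduces to Hahn-Banach.  A bounded functional [phi] on a module
   [N] induces the module map [n |-> (a |-> phi (n a))] into the dual of the
   algebra, and [phi] is recovered from it by evaluation at the unit.  Hence a
   module map into the dual is extended by extending the functional
   [m |-> f m 1], while points of [N] are separated, and their norms attained,
   by norming functionals. *)
Require Import Defs.
From HB Require Import structures.
From mathcomp Require Import all_boot all_order all_algebra.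
From mathcomp Require Import complex.
From mathcomp Require Import boolp classical_sets reals topology normedtype.
From mathcomp Require Import ring lra.

Set Implicit Arguments.
Unset Strict Implicit.
Unset Printing Implicit Defensive.

Import Order.TTheory GRing.Theory Num.Def Num.Theory.

Local Open Scope classical_set_scope.
Local Open Scope ring_scope.

(** * The real Hahn-Banach theorem for sublinear bounds *)

Section real_hahn_banach.
Variables (R : realType) (V : lmodType R) (p : V -> R).
Hypothesis pD : forall x y, p (x + y) <= p x + p y.
Hypothesis pZ : forall c x, 0 <= c -> p (c *: x) = c * p x.

Definition dominated_graph (G : set (V * R)) :=
  (forall (c : R) u v, G u -> G v -> G (c *: u.1 + v.1, c * u.2 + v.2)) /\
  (forall u, G u -> u.2 <= p u.1).

Lemma dominated_graphZ G (c : R) u :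
  dominated_graph G -> G u -> G (c *: u.1, c * u.2).
Proof.
move=> [Gl _] Gu; have := Gl c _ _ Gu (Gl (-1) _ _ Gu Gu).
by rewrite /= scaleN1r mulN1r !addNr !addr0.
Qed.

(* [(0, a - b)] and its opposite both lie in the graph, and [p 0 = 0]. *)
Lemma dominated_graph_fun G x a b :
  dominated_graph G -> G (x, a) -> G (x, b) -> a = b.
Proof.
have p0 : p 0 = 0 by rewrite -(scale0r 0) pZ// mul0r.
have le c d : dominated_graph G -> G (x, c) -> G (x, d) -> d <= c.
  move=> [Gl Gp] Gc Gd; have := Gp _ (Gl (-1) _ _ Gc Gd).
  by rewrite /= scaleN1r mulN1r addNr p0 addrC subr_le0.
by move=> dG Ga Gb; apply/eqP; rewrite eq_le !(le _ _ dG).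
Qed.

(** A value at [x0] must lie above every [u.2 - p (u.1 - x0)] and below every [p (v.1 + x0) - v.2].
    Subadditivity puts each lower bound under each upper one, so the supremum of the lower bounds
    works. *)
Lemma dominated_graph_extend G x0 : dominated_graph G -> G (0, 0) ->
  exists2 H, dominated_graph H & G `<=` H /\ exists a, H (x0, a).
Proof.
move=> dG G0; have [Gl Gp] := dG.
pose E := [set u.2 - p (u.1 - x0) | u in G].
have EG v : G v -> ubound E (p (v.1 + x0) - v.2).
  move=> Gv _ [u Gu <-]; rewrite lerBlDr addrAC lerBrDr.
  have := Gp _ (Gl 1 _ _ Gu Gv); rewrite /= scale1r mul1r => /le_trans; apply.
  by rewrite [leRHS]addrC (le_trans _ (pD _ _))// addrACA addNr addr0.
have E0 : E !=set0 by exists (0 - p (0 - x0)); exists (0, 0).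
have Ele u : G u -> u.2 - p (u.1 - x0) <= sup E.
  move=> Gu; apply: ub_le_sup; last by exists u.
  by exists (p (0 + x0) - 0); exact: EG G0.
have leE u : G u -> sup E <= p (u.1 + x0) - u.2.
  by move=> Gu; apply: ge_sup => //; exact: EG.
exists [set w | exists u t, G u /\ w = (u.1 + t *: x0, u.2 + t * sup E)].
  split=> [c _ _ [u [t [Gu ->]]] [v [s [Gv ->]]]|_ [u [t [Gu ->]]]] /=.
    exists (c *: u.1 + v.1, c * u.2 + v.2), (c * t + s); split; first exact: Gl.
    congr pair => /=; last by ring.
    by rewrite scalerDr scalerDl scalerA addrACA.
  (* Dividing by the absolute value of [t] reduces to coefficient -1 or 1: the lower bounds settle
     negative [t], the upper bounds positive [t]. *)
  have [t0|t0|->] := ltgtP t 0; last by rewrite scale0r mul0r !addr0 Gp.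
    have nt0 : 0 < - t by rewrite oppr_gt0.
    have := Ele _ (dominated_graphZ (- t)^-1 dG Gu).
    rewrite -(ler_pM2l nt0) /= mulrBr -(pZ _ (ltW nt0)) scalerBr scalerA mulrA.
    rewrite mulfV ?gt_eqF// scale1r mul1r scaleNr opprK; lra.
  have := leE _ (dominated_graphZ t^-1 dG Gu).
  rewrite -(ler_pM2l t0) /= mulrBr -(pZ _ (ltW t0)) scalerDr scalerA mulrA.
  rewrite mulfV ?gt_eqF// scale1r mul1r; lra.
split=> [[x a] Gu|].
  by exists (x, a), 0; rewrite scale0r mul0r !addr0.
by exists (sup E); exists (0, 0), 1; rewrite scale1r mul1r !add0r.
Qed.

Lemma maximal_dominated_graph G0 : dominated_graph G0 -> G0 (0, 0) ->
  exists2 G, dominated_graph G & G0 `<=` G /\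
    forall H, dominated_graph H -> G `<=` H -> H `<=` G.
Proof.
move=> dG0 G00.
(* The empty graph is allowed because [Zorn_bigcup] includes the empty chain. *)
have [F FP totF|G [[dG GG0] Gmax]] := @Zorn_bigcup _
    [set G | dominated_graph G /\ forall u, G u -> G0 `<=` G].
  split; last first.
    move=> u [X FX Xu] w G0w; exists X => //; have [_ XG0] := FP _ FX.
    exact: XG0 Xu _ G0w.
  split; last by move=> u [X FX Xu]; have [[_ Xp] _] := FP _ FX; exact: Xp.
  move=> c u v [X FX Xu] [Y FY Yv]; have [[Xl _] _] := FP _ FX.
  have [[Yl _] _] := FP _ FY; have [XY|YX] := totF _ _ FX FY.
    by exists Y => //; apply: Yl => //; exact: XY.
  by exists X => //; apply: Xl => //; exact: YX.
have maxG H : dominated_graph H -> (forall u, H u -> G0 `<=` H) ->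
    G `<=` H -> H `<=` G.
  by move=> dH HG0 GH; apply: contrapT => nHG; exact: (Gmax H).
(* If [G] were empty, maximality applied to [G0] itself would still give the inclusion. *)
have {}GG0 : G0 `<=` G.
  have [G_0|/set0P[u /GG0//]] := eqVneq G set0.
  by apply: maxG => [//|u _ //|]; rewrite G_0; exact: sub0set.
exists G => //; split=> // H dH GH; apply: maxG => // u _.
exact: subset_trans GH.
Qed.

(** Extending along a linear map [j] covers both submodules and lines. Injectivity of [j] is not
    assumed: domination makes the graph of pairs [(j x, f x)] single-valued. *)
Lemma real_hahn_banach (W : lmodType R) (j : W -> V) (f : W -> R) :
  linear j -> (forall c x y, f (c *: x + y) = c * f x + f y) ->
  (forall x, f x <= p (j x)) ->
  exists g : V -> R, [/\ forall c x y, g (c *: x + y) = c * g x + g y,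
    forall x, g x <= p x & forall x, g (j x) = f x].
Proof.
move=> jl fl fp; pose G0 := [set (j x, f x) | x in [set: W]].
have dG0 : dominated_graph G0.
  split=> [c _ _ [x _ <-] [y _ <-]|_ [x _ <-]] //=.
  by exists (c *: x + y); rewrite // jl fl.
have G00 : G0 (0, 0).
  exists 0 => //; congr pair.
    by have := jl (-1) 0 0; rewrite !scaleN1r !addNr.
  by have := fl (-1) 0 0; rewrite scaleN1r mulN1r !addNr.
have [G dG [G0G Gmax]] := maximal_dominated_graph dG0 G00.
(* A maximal graph absorbs its own extension to [x], so it is defined everywhere. *)
have /choice[g Gg] x : exists a, G (x, a).
  have [H dH [GH [a Ha]]] := dominated_graph_extend x dG (G0G _ G00).
  by exists a; exact: Gmax Ha.
exists g; split=> [c x y|x|x].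
- by apply: (dominated_graph_fun dG (Gg _)); exact: dG.1 (Gg x) (Gg y).
- exact: dG.2 (Gg x).
- by apply: (dominated_graph_fun dG (Gg _)); apply: G0G; exists x.
Qed.

End real_hahn_banach.

(** * Restriction of scalars and the complex Hahn-Banach theorem *)

Definition realification (R : realType) (X : lmodType R[i]) : Type := X.

Section realification.
Variables (R : realType) (X : lmodType R[i]).
Local Notation XR := (realification X).

HB.instance Definition _ := GRing.Zmodule.copy XR X.

Definition real_scale (r : R) (x : XR) : XR := (r%:C%C *: (x : X) : X).

Lemma real_scaleA a b x : real_scale a (real_scale b x) = real_scale (a * b) x.
Proof. by rewrite /real_scale scalerA -rmorphM. Qed.

Lemma real_scale1 : left_id 1 real_scale.
Proof. exact: scale1r. Qed.

Lemma real_scaleDr : right_distributive real_scale +%R.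
Proof. by move=> a x y; exact: scalerDr. Qed.

Lemma real_scaleDl x : {morph real_scale^~ x : a b / a + b}.
Proof. by move=> a b; rewrite /real_scale rmorphD; exact: scalerDl. Qed.

HB.instance Definition _ := GRing.Zmodule_isLmodule.Build R XR
  real_scaleA real_scale1 real_scaleDr real_scaleDl.

End realification.

(* A complex functional is determined by its real part [u], as
   [x |-> u x - i * u (i *: x)]. *)
Lemma complex_hahn_banach (R : realType) (X : normedModType R[i])
    (W : lmodType R[i]) (j : W -> X) (f : W -> R[i]^o) :
  linear j -> linear f -> (forall x, `|f x| <= `|j x|) ->
  exists g : X -> R[i]^o, [/\ linear g, forall x, `|g x| <= `|x| &
    forall x, g (j x) = f x].
Proof.
move=> jl fl fj.
have jZ c x : j (c *: x) = c *: j x.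
  have j0 : j 0 = 0 by have := jl (-1) 0 0; rewrite !scaleN1r !addNr.
  by have := jl c x 0; rewrite j0 !addr0.
have fZ c x : f (c *: x) = c * f x.
  have f0 : f 0 = 0 by have := fl (-1) 0 0; rewrite !scaleN1r !addNr.
  by have := fl c x 0; rewrite f0 !addr0.
have Re_le (z w : R[i]) : z <= w -> complex.Re z <= complex.Re w.
  by rewrite lecE => /andP[].
(* Norms on [X] are complex scalars with zero imaginary part; the real part turns them into a real
   sublinear bound. *)
pose p (x : realification X) : R := complex.Re `|x : X|.
have [|||||u [ul up uj]] := @real_hahn_banach R (realification X) p _ _
    (realification W) j (fun x => complex.Re (f x)).
- by move=> x y; rewrite /p -raddfD; apply/Re_le/ler_normD.
- move=> c x c0; rewrite /p [`|_|](_ : _ = c%:C%C * `|x : X|).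
    by case: `|x : X| => a b /=; rewrite mul0r subr0.
  by rewrite -[LHS]/`|c%:C%C *: (x : X)| normrZ ger0_norm// ler0c.
- by move=> c x y; exact: jl.
- move=> c x y; rewrite -[_ + _]/(c%:C%C *: (x : W) + y) fl raddfD.
  by congr (_ + _); case: (f x) => a b /=; rewrite mul0r subr0.
- move=> x; apply: (le_trans _ (Re_le _ _ (fj x))).
  rewrite normc_def; case: (f x) => a b /=.
  by rewrite (le_trans (ler_norm _))// -sqrtr_sqr ler_wsqrtr// lerDl sqr_ge0.
have uD (x y : X) : u (x + y) = u x + u y.
  by have := ul 1 x y; rewrite scale1r mul1r.
have u0 : u 0 = 0 by apply: (addrI (u 0)); rewrite -uD !addr0.
have uZ (r : R) (x : X) : u (r%:C%C *: x) = r * u x.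
  by have := ul r x 0; rewrite u0 !addr0.
pose g (x : X) : R[i]^o := (u x +i* - u ('i%C *: x))%C.
have uE (a b : R) (z : X) : u ((a +i* b)%C *: z) = a * u z + b * u ('i%C *: z).
  by rewrite [(a +i* b)%C]complexE scalerDl uD mulrC -scalerA !uZ.
have uN (z : X) : u ('i%C *: ('i%C *: z)) = - u z.
  by rewrite scalerA -expr2 sqr_i -[-1](rmorphN1 (real_complex R)) uZ mulN1r.
have gl : linear g.
  move=> [a b] x y; rewrite /g.
  have -> : 'i%C *: ((a +i* b)%C *: x + y) =
      (a +i* b)%C *: ('i%C *: x) + 'i%C *: y.
    by rewrite scalerDr !scalerA mulrC.
  rewrite (uD _ y) (uD _ ('i%C *: y)) (uE a b x)
    (uE a b ('i%C *: x)) uN.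
  rewrite -[RHS]/((a +i* b)%C * (u x +i* - u ('i%C *: x))%C
    + (u y +i* - u ('i%C *: y))%C).
  move: (u x) (u y) (u _) (u _) => ux uy uix uiy.
  by simpc; congr (_ +i* _)%C; ring.
exists g; split=> // x.
  have gZ c y : g (c *: y) = c * g y.
    have g0 : g 0 = 0 by rewrite /g scaler0 u0 oppr0.
    by have := gl c y 0; rewrite g0 !addr0.
  (* Rotating by [c] makes the value real: the norm of [g x] equals [g (c *: x)], hence its real
     part [u (c *: x)], which [p] bounds. *)
  have [c c1 cg] : exists2 c : R[i], `|c| <= 1 & c * g x = `|g x|.
    have [g0|gn0] := eqVneq (g x) 0.
      by exists 0; rewrite ?normr0// g0 mulr0 normr0.
    have ng : `|g x| != 0 by rewrite normr_eq0.
    exists ((g x)^*%C / `|g x|).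
      by rewrite normrM normcJ normfV normr_id mulfV.
    by rewrite mulrAC [_ * g x]mulrC -sqr_normc expr2 mulfK.
  have : complex.Re `|g x| <= complex.Re `|x|.
    rewrite -cg -gZ (le_trans (up _))// /p; apply: Re_le.
    by rewrite normrZ ler_piMl.
  by rewrite lecE !ger0_Im// eqxx.
have jiZ y : u ('i%C *: j y) = - complex.Im (f y).
  by rewrite -jZ uj fZ mulrC ReiNIm.
by rewrite /g uj jiZ opprK; case: (f x).
Qed.

(** * Contractive extension and norming functionals over either scalar field *)

Lemma hahn_banach (R : realType) (k : scalar_kind)
    (X : normedModType (scalarField R k)) (W : lmodType (scalarField R k))
    (j : W -> X) (f : W -> (scalarField R k)^o) :
  linear j -> linear f -> (forall x, `|f x| <= `|j x|) ->
  exists2 g : dual_space X, `|g| <= 1 & forall x, g (j x) = f x.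
Proof.
move=> jl fl fj.
have [g [gl gn gj]] : exists g : X -> (scalarField R k)^o,
    [/\ linear g, forall x, `|g x| <= `|x| & forall x, g (j x) = f x].
  case: k X W j f jl fl fj => X W j f jl fl fj; last exact: complex_hahn_banach.
  have [|||||g [gl gn gj]] := @real_hahn_banach R X (fun x => `|x|) _ _ W j f.
  - exact: ler_normD.
  - by move=> c x c0; rewrite normrZ ger0_norm.
  - exact: jl.
  - exact: fl.
  - by move=> x; rewrite (le_trans (ler_norm _)).
  exists g; split=> // x; rewrite ler_norml gn andbT lerNl.
  have g0 : g 0 = 0 by have := gl (-1) 0 0; rewrite scaleN1r mulN1r !addNr.
  have := gl (-1) x 0; rewrite g0 !addr0 scaleN1r mulN1r => <-.
  by rewrite -[`|x|]normrN gn.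
have gP : g \in is_functional X.
  by apply: is_functionalP => //; exists 1 => x; rewrite mul1r.
exists (Dual gP) => //; apply: dual_le => // x.
by rewrite mul1r gn.
Qed.

(** Extend [c * |x|] along the line [c *: x]; the case [x = 0] needs no separate treatment, as [j]
    may fail to be injective. *)
Lemma norming_functional (R : realType) (k : scalar_kind)
    (X : normedModType (scalarField R k)) (x : X) :
  exists2 g : dual_space X, `|g| <= 1 & g x = `|x|.
Proof.
have [|||g g1 gx] := @hahn_banach R k X (scalarField R k)^o
    (fun c => c *: x) (fun c => c * `|x|).
- by move=> a b c; rewrite scalerDl scalerA.
- by move=> a b c; rewrite -[RHS]/(a * (b * `|x|) + c * `|x|) mulrDl mulrA.
- by move=> c; rewrite normrM normr_id normrZ.
by exists g => //; have := gx 1; rewrite scale1r mul1r.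
Qed.

(** * Module maps into the dual of the algebra *)

Lemma orbit_functional_hom (R : realType) (k : scalar_kind)
    (A : banachAlgType (scalarField R k)) (M : banachModType A)
    (f : dual_space M) :
  `|f| <= 1 -> contractive_hom (orbit_functional f).
Proof.
move=> f1; split; [split=> [c m n|m a]|move=> m].
- by apply: dual_ext => a; rewrite /= ractDl ractZl linearP.
- by apply: dual_ext => b; rewrite /= ractA.
- by rewrite (le_trans (orbit_functional_le _ _))// ler_piMl.
Qed.

Theorem theorem4p2p1 (R : realType) (k : scalar_kind)
    (A : banachAlgType (scalarField R k)) :
  (forall (M N : banachModType A) (alpha beta : M -> N),
     contractive_hom alpha -> contractive_hom beta -> alpha <> beta ->
     exists phi : N -> dual_space A,
       contractive_hom phi /\ phi \o alpha <> phi \o beta) /\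
  (forall M : banachModType A, isometric_hom (@canonical_map R k A M)) /\
  (forall (N : banachModType A) (M : closedSubmodule N)
     (f : submodule M -> dual_space A),
     contractive_hom f ->
     exists g : N -> dual_space A,
       contractive_hom g /\
       forall m : submodule M, g (submodule_val m) = f m).
Proof.
split; [|split].
- move=> M N alpha beta _ _ ab.
  have [m abm] : exists m, alpha m != beta m.
    apply: contrapT => nab; apply: ab; apply/funext => m.
    by apply: contrapT => /eqP abm; apply: nab; exists m.
  have [h h1 hE] := norming_functional (alpha m - beta m).
  exists (orbit_functional h); split; first exact: orbit_functional_hom.
  (* Evaluating at the unit gives [h (alpha m) = h (beta m)], whereas [h] sends the difference to
     its nonzero norm. *)
  move=> /(congr1 (fun F : M -> dual_space A => F m bone)) /=.
  rewrite !ract1 => hab; move: abm; rewrite -subr_eq0 -normr_eq0 -hE.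
  by rewrite linearB /= hab subrr eqxx.
- move=> M; split; first split.
  + by move=> c m n; apply: linf_ext => -[f f1]; exact: (orbit_functional_hom f1).1.1.
  + by move=> m a; apply: linf_ext => -[f f1]; exact: (orbit_functional_hom f1).1.2.
  move=> m; apply/eqP; rewrite eq_le; apply/andP; split.
    by apply: linf_le => // -[f f1]; exact: (orbit_functional_hom f1).2.
  (* The component indexed by [g] takes the value [g m], the norm of [m], at the unit. As the unit
     has norm at most 1, that component already has norm at least that of [m]. *)
  have [g g1 gm] := norming_functional m.
  rewrite -[leLHS]normr_id -gm -[X in g X]ract1.
  have := ler_dual (orbit_functional g m) bone => /le_trans; apply.
  rewrite (le_trans (ler_piMr _ (ler_norm_bone)))//.
  exact: (ler_linf (canonical_map m) (exist _ g g1)).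
move=> N M f [[fl fr] fn].
have [|||h h1 hf] := @hahn_banach R k N (submodule M) (@submodule_val _ _ _ M)
    (fun m => f m bone).
- by [].
- by move=> c m n; rewrite fl.
- move=> m; rewrite (le_trans (ler_dual _ _))//.
  by rewrite (le_trans (ler_piMr _ (ler_norm_bone)))// fn.
exists (orbit_functional h); split; first exact: orbit_functional_hom.
(* At [a] the extension gives [h (m a) = f (m a) 1 = (f m . a) 1 = f m (a 1)]. *)
move=> m; apply: dual_ext => a /=.
by rewrite (hf (ract m a)) fr /= bmul1r.
Qed.
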